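(* Let $n\ge 2$ and let $C\in\{0,1\}^{n\times n}$ be the matrix with $C_{ij}=0$ if $j=i$ or $j=i+1$, and $C_{ij}=1$ otherwise ($1\le i,j\le n$). Let $\varepsilon\in(0,1)$ and $\eta>0$. Let $X^*$ be an optimal solution of $\min_{X\in B}\langle C,X\rangle$ over the Birkhoff polytope $B$ of $n\times n$ doubly stochastic matrices, and let $X^\eta$ be the optimal solution of the entropy-penalized program with parameter $\eta$. If $\eta\le n\log\frac{1-\varepsilon}{\varepsilon}$, then $$\langle C,X^\eta\rangle-\langle C,X^*\rangle\ \ge\ \varepsilon.$$
   Context: The Birkhoff polytope is $B=\{X\in\mathbb{R}^{n\times n}: X\mathbf 1=\mathbf 1,\ X^\top\mathbf 1=\mathbf 1,\ X\ge 0\}$, where $\mathbf 1$ is the all-ones vector, and $\langle C,X\rangle=\sum_{i,j}C_{ij}X_{ij}$. For nonnegative $X$, $H(X)=\sum_{i,j}X_{ij}\log\frac1{X_{ij}}$ (natural logarithm, $0\log\frac10=0$). $X^\eta$ is the (unique) minimizer of $\langle C,X\rangle-\eta^{-1}H(X)$ over $X\in B$. *)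

(* Defs.v *)
From HB Require Import structures.
From mathcomp Require Import all_boot all_order all_algebra.
From mathcomp Require Import classical_sets reals exp.

Set Implicit Arguments.
Unset Strict Implicit.
Unset Printing Implicit Defensive.

Import Order.TTheory GRing.Theory Num.Theory.

Local Open Scope classical_set_scope.
Local Open Scope ring_scope.

Definition birkhoff (R : realType) (n : nat) : set 'M[R]_n :=
  [set X | [/\ X *m const_mx 1 = const_mx 1 :> 'cV[R]_n,
               X^T *m const_mx 1 = const_mx 1 :> 'cV[R]_n
             & forall i j, 0 <= X i j]].
Arguments birkhoff : clear implicits.

Definition mxdot (R : realType) (n : nat) (C X : 'M[R]_n) : R :=
  \sum_i \sum_j C i j * X i j.

(* The convention 0 log (1/0) = 0 holds since the factor X i j vanishes and
   ln is total. *)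
Definition entropy (R : realType) (n : nat) (X : 'M[R]_n) : R :=
  \sum_i \sum_j X i j * ln (1 / X i j).

Definition is_minimizer (R : realType) (T : Type) (f : T -> R) (A : set T)
    (x : T) : Prop :=
  A x /\ forall y, A y -> f x <= f y.

Definition ot_optimal (R : realType) (n : nat) (C X : 'M[R]_n) : Prop :=
  is_minimizer (mxdot C) (birkhoff R n) X.

Definition entropic_ot_optimal (R : realType) (n : nat) (C : 'M[R]_n)
    (eta : R) (X : 'M[R]_n) : Prop :=
  is_minimizer (fun Y => mxdot C Y - eta^-1 * entropy Y) (birkhoff R n) X.

(* Indices run from 0 to n - 1; the condition j = i + 1 does not wrap around
   modulo n, so the last row has a single zero entry. *)
Definition bidiag_cost (R : realType) (n : nat) : 'M[R]_n :=
  \matrix_(i, j) (if (j == i :> nat) || (j == i.+1 :> nat) then 0 else 1).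
Arguments bidiag_cost : clear implicits.

(* Main.v *)
(** Put d = <C, X^eta>; since the identity has cost 0 it suffices that eps <= d.
    Feasible dual solutions show that the diagonal entries of X^eta are at least
    1 - d and that its entries on the cyclic superdiagonal are at most d. If
    d < eps, move X^eta by t = (eps - d) / 2 towards the cyclic permutation and
    away from the identity: this costs t, while by concavity the entropy grows
    by at least t times the sum of the logarithmic ratios of diagonal to cyclic
    superdiagonal entries of the new matrix, each of which exceeds
    ln ((1 - eps) / eps). So the penalized objective strictly decreases when
    eta <= n ln ((1 - eps) / eps). *)
Require Import Defs.
From HB Require Import structures.
From mathcomp Require Import all_boot all_order all_algebra perm.
From mathcomp Require Import classical_sets reals exp.
From mathcomp Require Import zify lra.

Set Implicit Arguments.
Unset Strict Implicit.
Unset Printing Implicit Defensive.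

Import Order.TTheory GRing.Theory Num.Theory.
Local Open Scope ring_scope.

(** * Duality and entropy estimates on the Birkhoff polytope *)

Section Birkhoff.
Variables (R : realType) (n : nat).
Implicit Types (C X Y : 'M[R]_n) (s : 'S_n).

Lemma mxdotDr C X Y : mxdot C (X + Y) = mxdot C X + mxdot C Y.
Proof.
rewrite /mxdot -big_split; apply: eq_bigr => i _; rewrite -big_split.
by apply: eq_bigr => j _; rewrite mxE mulrDr.
Qed.

Lemma mxdotZr a C X : mxdot C (a *: X) = a * mxdot C X.
Proof.
rewrite /mxdot mulr_sumr; apply: eq_bigr => i _; rewrite mulr_sumr.
by apply: eq_bigr => j _; rewrite mxE mulrCA.
Qed.

Lemma mxdotC C X : mxdot C X = mxdot X C.
Proof. by apply: eq_bigr => i _; apply: eq_bigr => j _; rewrite mulrC. Qed.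

Lemma ler_mxdot C C' X : (forall i j, 0 <= X i j) ->
  (forall i j, C i j <= C' i j) -> mxdot C X <= mxdot C' X.
Proof.
move=> X0 CC'; apply: ler_sum => i _; apply: ler_sum => j _.
exact: ler_wpM2r.
Qed.

Lemma mxdot_perm C s : mxdot C (perm_mx s) = \sum_i C i (s i).
Proof.
apply: eq_bigr => i _; rewrite (bigD1 (s i)) //= big1 => [|j ji].
  by rewrite !mxE eqxx mulr1 addr0.
by rewrite !mxE eq_sym (negbTE ji) mulr0.
Qed.

Lemma mxdot_delta X i j : mxdot (delta_mx i j) X = X i j.
Proof.
rewrite /mxdot (bigD1 i) //= [X in _ + X]big1 ?addr0 => [|k ki].
  rewrite (bigD1 j) //= [X in _ + X]big1 => [|l lj].
    by rewrite mxE !eqxx mul1r addr0.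
  by rewrite mxE (negbTE lj) andbF mul0r.
by apply: big1 => l _; rewrite mxE (negbTE ki) mul0r.
Qed.

Lemma birkhoffP X : birkhoff R n X <->
  [/\ forall i, \sum_j X i j = 1, forall j, \sum_i X i j = 1
    & forall i j, 0 <= X i j].
Proof.
split=> -[r c p]; split=> //.
- move=> i; have /matrixP/(_ i 0) := r; rewrite !mxE => <-.
  by apply: eq_bigr => j _; rewrite mxE mulr1.
- move=> j; have /matrixP/(_ j 0) := c; rewrite !mxE => <-.
  by apply: eq_bigr => i _; rewrite !mxE mulr1.
- apply/matrixP => i k; rewrite !mxE -[RHS](r i).
  by apply: eq_bigr => j _; rewrite mxE mulr1.
- apply/matrixP => j k; rewrite !mxE -[RHS](c j).
  by apply: eq_bigr => i _; rewrite !mxE mulr1.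
Qed.

Lemma birkhoff_perm s : birkhoff R n (perm_mx s).
Proof.
apply/birkhoffP; split=> [i|j|i j]; last by rewrite !mxE ler0n.
- rewrite (bigD1 (s i)) //= big1 => [|j ji]; first by rewrite !mxE eqxx addr0.
  by rewrite !mxE eq_sym (negbTE ji).
- rewrite (bigD1 (s^-1%g j)) //= big1 => [|i ij].
    by rewrite !mxE permKV eqxx addr0.
  by rewrite !mxE -(inj_eq (perm_inj (s := s^-1%g))) permK (negbTE ij).
Qed.

Lemma mxdot_dual (f g : 'I_n -> R) X : birkhoff R n X ->
  mxdot (\matrix_(i, j) (f i + g j)) X = \sum_i f i + \sum_j g j.
Proof.
move=> /birkhoffP[r c _]; rewrite /mxdot.
under eq_bigr do under eq_bigr do rewrite mxE mulrDl.
under eq_bigr do rewrite big_split.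
rewrite big_split /=; congr (_ + _).
  by apply: eq_bigr => i _; rewrite -mulr_sumr r mulr1.
by rewrite exchange_big; apply: eq_bigr => j _; rewrite -mulr_sumr c mulr1.
Qed.

(** Row and column sums equal to 1 turn the potentials [f], [g] into a constant. With [C] a signed
    [delta_mx], this bounds a single entry of [X] by its cost under [C']. *)
Lemma mxdot_weak_duality (f g : 'I_n -> R) C C' X : birkhoff R n X ->
  (forall i j, f i + g j + C i j <= C' i j) ->
  \sum_i f i + \sum_j g j + mxdot C X <= mxdot C' X.
Proof.
move=> BX CC'; have /birkhoffP[_ _ X0] := BX.
rewrite -(mxdot_dual _ _ BX) mxdotC [mxdot C X]mxdotC -mxdotDr mxdotC.
by apply: ler_mxdot => // i j; rewrite !mxE.
Qed.

(** The concave function [x * ln (1 / x)] lies below its tangent at [y]; for positive [x] and [y]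
    this is [ln (1 + u) <= u] at [u = y / x - 1]. *)
Lemma xlnx_tangent (x y : R) : 0 <= x -> 0 < y \/ y = x ->
  x * ln (1 / x) - y * ln (1 / y) <= (y - x) * ln y + (y - x).
Proof.
move=> x0 [y0|->]; last by rewrite !subrr mul0r addr0.
rewrite !div1r (lnV (x := y)) ?posrE//.
have [->|xN0] := eqVneq x 0; first by rewrite mul0r; lra.
have {xN0}x_gt0 : 0 < x by rewrite lt_def xN0.
rewrite (lnV (x := x)) ?posrE//.
have yx0 : 0 < y / x by rewrite divr_gt0.
have : ln (1 + (y / x - 1)) <= y / x - 1 by apply: le_ln1Dx; lra.
rewrite addrC subrK ln_div ?posrE//.
move=> /(ler_wpM2l x0); rewrite !mulrBr mulr1 mulrCA divff ?gt_eqF// mulr1.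
lra.
Qed.

Lemma entropy_tangent X Y : birkhoff R n X -> birkhoff R n Y ->
  (forall i j, 0 < Y i j \/ Y i j = X i j) ->
  entropy X - entropy Y <= mxdot (map_mx (@ln R) Y) (Y - X).
Proof.
move=> /birkhoffP[rX _ X0] /birkhoffP[rY _ _] YX.
(* The non-logarithmic tangent terms cancel, since all row sums agree. *)
have YX0 : \sum_i \sum_j (Y i j - X i j) = 0.
  by apply: big1 => i _; rewrite sumrB rX rY subrr.
rewrite -[leRHS]addr0 -YX0 /entropy /mxdot -sumrB -big_split /=.
apply: ler_sum => i _; rewrite -sumrB -big_split /=.
apply: ler_sum => j _; rewrite !mxE [ln _ * _]mulrC.
exact: xlnx_tangent.
Qed.

(** A first-order optimality condition with the logarithms taken at the competitor [Y], so that
    entries of [X] may vanish. *)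
Lemma entropic_ot_tangent C eta X Y : 0 < eta ->
  entropic_ot_optimal C eta X -> birkhoff R n Y ->
  (forall i j, 0 < Y i j \/ Y i j = X i j) ->
  0 <= eta * mxdot C (Y - X) + mxdot (map_mx (@ln R) Y) (Y - X).
Proof.
move=> eta0 [BX opt] BY YX; have := opt _ BY.
have := entropy_tangent BX BY YX.
rewrite [mxdot C (Y - X)]mxdotDr -scaleN1r mxdotZr mulN1r => tang.
rewrite -(ler_pM2l eta0) !mulrBr !mulrA divff ?gt_eqF// !mul1r.
lra.
Qed.

End Birkhoff.

(** * Entry bounds from the bidiagonal cost *)

Section BidiagonalCost.
Variables (R : realType) (n : nat).
Implicit Types X : 'M[R]_n.+1.

Local Notation C := (bidiag_cost R n.+1).

(** The zero-cost superdiagonal, closed up by the bottom-left corner. The size is [n.+1], so [0 < n]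
    below excludes the size at which this is the identity. *)
Definition cycle_perm : 'S_n.+1 := perm (bij_inj (@ordS_bij n.+1)).

Lemma bidiag_cost_diag i : C i i = 0.
Proof. by rewrite mxE eqxx. Qed.

Lemma bidiag_cost_cycle i : (0 < n)%N -> C i (cycle_perm i) = (i == ord_max)%:R.
Proof.
move=> n0; rewrite mxE permE /= -val_eqE /=.
have [->|ni] := eqVneq (i : nat) n.
  by rewrite modnn; case: n n0.
by rewrite modn_small ?eqxx ?orbT// ltnS ltn_neqAle ni -ltnS ltn_ord.
Qed.

Lemma cycle_perm_neq i : (0 < n)%N -> cycle_perm i != i.
Proof.
move=> n0; rewrite permE -val_eqE /=.
have [->|ni] := eqVneq (i : nat) n; first by rewrite modnn; lia.
rewrite modn_small; first by lia.
by rewrite ltnS ltn_neqAle ni -ltnS ltn_ord.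
Qed.

Lemma sum_ltn_ord k : (k <= n.+1)%N -> \sum_(i < n.+1) (i < k)%:R = k%:R :> R.
Proof.
move=> kn; rewrite -natr_sum; congr _%:R.
by rewrite -big_mkcond /= -(big_ord_widen _ (fun=> 1%N)) // sum1_card card_ord.
Qed.

Lemma birkhoff_diag_ge X i : birkhoff R n.+1 X -> 1 - mxdot C X <= X i i.
Proof.
move=> BX.
(* The potentials add up to 1 only where [j <= i <= k]; in that block the cost is 1 except at
   [(i, i)], which the delta corrects. Their total is [i.+1 - i = 1]. *)
have := @mxdot_weak_duality _ _ (fun k => - (k < i)%:R) (fun j => (j < i.+1)%:R)
  (- delta_mx i i) C X BX.
rewrite sumrN !sum_ltn_ord ?(ltnW (ltn_ord i))// -scaleN1r.
rewrite mxdotC mxdotZr mxdotC mxdot_delta -natr1 => dual.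
suff /dual : forall k j : 'I_n.+1, - (k < i)%:R + (j < i.+1)%:R +
  (-1 *: delta_mx i i : 'M[R]_n.+1) k j <= C k j by lra.
move=> k j; rewrite !mxE -!val_eqE /=.
case: (ltnP k i); case: (ltnP j i.+1);
  do 2?case: eqP; do 2?case: eqP => /=; try lra; lia.
Qed.

Lemma birkhoff_cycle_le X i : (0 < n)%N -> birkhoff R n.+1 X ->
  X i (cycle_perm i) <= mxdot C X.
Proof.
move=> n0 BX.
(* The potentials total 0. For [i < n] they give -1 at [(i, i.+1)], leaving room for the delta; for
   [i = n] they vanish everywhere and the corner has cost 1. *)
have := @mxdot_weak_duality _ _ (fun k => - (k < i.+1)%:R)
  (fun j => (j < i.+1)%:R) (delta_mx i (cycle_perm i)) C X BX.
rewrite sumrN !sum_ltn_ord ?ltn_ord// mxdot_delta addNr add0r; apply.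
move=> k j; rewrite !mxE -!val_eqE permE /=.
have [i_n|iN] := eqVneq (i : nat) n.
  rewrite i_n modnn; have := ltn_ord k.
  case: (ltnP k n.+1); case: (ltnP j n.+1);
    do 2?case: eqP; do 2?case: eqP => /=; try lra; lia.
rewrite modn_small; last by rewrite ltnS ltn_neqAle iN -ltnS ltn_ord.
case: (ltnP k i.+1); case: (ltnP j i.+1);
  do 2?case: eqP; do 2?case: eqP => /=; try lra; lia.
Qed.

End BidiagonalCost.

Theorem theorem2 (R : realType) (n : nat) (eps eta : R)
    (Xstar Xeta : 'M[R]_n) :
  (2 <= n)%N ->
  0 < eps < 1 ->
  0 < eta ->
  ot_optimal (bidiag_cost R n) Xstar ->
  entropic_ot_optimal (bidiag_cost R n) eta Xeta ->
  eta <= n%:R * ln ((1 - eps) / eps) ->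
  eps <= mxdot (bidiag_cost R n) Xeta - mxdot (bidiag_cost R n) Xstar.
Proof.
case: n Xstar Xeta => // n Xstar X n0 /andP[e0 e1] eta0 [_ optS] optX eta_le.
set C := bidiag_cost R n.+1.
have BX : birkhoff R n.+1 X by case: optX.
have C1 : mxdot C (perm_mx 1%g) = 0.
  by rewrite mxdot_perm big1// => i _; rewrite perm1 bidiag_cost_diag.
have := optS _ (birkhoff_perm R 1%g); rewrite -/C C1 => CS.
rewrite lerBrDr; apply: le_trans (_ : eps <= _); first by lra.
rewrite leNgt; apply/negP => lt_eps.
(* Half the gap keeps [d + t < eps], so the entry bounds remain strict after the move. *)
set d := mxdot C X in lt_eps; pose t := (eps - d) / 2.
have t0 : 0 < t by rewrite /t; lra.
pose D : 'M[R]_n.+1 := perm_mx (cycle_perm n) - perm_mx 1%g.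
pose Y := X + t *: D.
have YXE : Y - X = t *: D by rewrite /Y addrC addKr.
have dotD A : mxdot A (Y - X) = t * \sum_i (A i (cycle_perm n i) - A i i).
  rewrite YXE mxdotZr mxdotDr -[- _]scaleN1r mxdotZr mulN1r !mxdot_perm sumrB.
  by congr (_ * (_ - _)); apply: eq_bigr => i _; rewrite perm1.
have YE i j : Y i j = X i j + t * ((cycle_perm n i == j)%:R - (i == j)%:R).
  by rewrite !mxE perm1.
have cN i := negbTE (cycle_perm_neq i n0).
have Ydiag i : 1 - eps < Y i i.
  have := birkhoff_diag_ge i BX; rewrite -/C -/d YE eqxx cN /t /=; lra.
have Ycyc i : 0 < Y i (cycle_perm n i) < eps.
  have := birkhoff_cycle_le i n0 BX; rewrite -/C -/d.
  have /birkhoffP[_ _ /(_ i (cycle_perm n i))] := BX.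
  rewrite YE eqxx [i == _]eq_sym cN /t /= => Xge Xle; apply/andP; split; lra.
have YX i j : 0 < Y i j \/ Y i j = X i j.
  have [<-|ij] := eqVneq i j; first by left; apply: lt_trans (Ydiag i); lra.
  have [<-|cij] := eqVneq (cycle_perm n i) j; first by left; case/andP: (Ycyc i).
  by right; rewrite YE (negbTE ij) (negbTE cij) subrr mulr0 addr0.
have BY : birkhoff R n.+1 Y.
  case: (BX) (birkhoff_perm R (1%g : 'S_n.+1)) (birkhoff_perm R (cycle_perm n)).
  move=> rX cX _ [r1 c1 _] [rc cc _]; split=> [||i j].
  - by rewrite mulmxDl -scalemxAl mulmxBl rX r1 rc subrr scaler0 addr0.
  - rewrite linearD linearZ linearB/= mulmxDl -scalemxAl mulmxBl cX c1 cc.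
    by rewrite subrr scaler0 addr0.
  - by have [/ltW|->] := YX i j => //; have /birkhoffP[_ _] := BX.
have := entropic_ot_tangent eta0 optX BY YX.
rewrite !dotD mulrCA -mulrDr pmulr_rge0//.
have -> : \sum_i (C i (cycle_perm n i) - C i i) = 1.
  under eq_bigr do rewrite bidiag_cost_diag subr0 bidiag_cost_cycle//.
  by rewrite (bigD1 ord_max) //= eqxx big1 ?addr0// => i /negbTE->.
have lnYE i j : map_mx (@ln R) Y i j = ln (Y i j) by rewrite mxE.
(* After division by [t], it remains to show that [eta] plus the sum of
   [ln (Y i (cycle_perm n i)) - ln (Y i i)] is negative. The bound on [eta] is split into [n.+1]
   equal shares, one per row. *)
rewrite mulr1 leNgt => /negP; apply.
apply: le_lt_trans (lerD eta_le (lexx _)) _.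
have -> : n.+1%:R * ln ((1 - eps) / eps) = \sum_(i < n.+1) ln ((1 - eps) / eps).
  by rewrite sumr_const card_ord mulr_natl.
rewrite -big_split; apply: (@lt_le_trans _ _ (\sum_(i < n.+1) 0)); last first.
  by rewrite big1.
apply: ltr_sum => [|i _].
  by apply/hasP; exists ord0; rewrite ?mem_index_enum.
rewrite /= !lnYE ln_div ?posrE ?subr_gt0//.
have /andP[c0 ce] := Ycyc i; have dY := Ydiag i.
have : ln (Y i (cycle_perm n i)) < ln eps by rewrite ltr_ln ?posrE.
have : ln (1 - eps) < ln (Y i i) by rewrite ltr_ln ?posrE//; lra.
lra.
Qed.
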